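(* Let $q$ be odd, let $u,v,w\in\mathbb F_q[x]$ be monic quadratics, let $\delta\in\mathbb F_q$, and write $\tilde s(x)=s(x+\delta)$ for a polynomial $s$. Then for each $s\in\{u,v,w\}$ $$\operatorname{Disc}(\tilde s)=\operatorname{Disc}(s),\qquad \operatorname{Res}(\tilde u,\tilde v)=\operatorname{Res}(u,v),\qquad \mathfrak d(\tilde u,\tilde v,\tilde w)=\mathfrak d(u,v,w),$$ and the brackets satisfy $[\tilde u,\tilde v](x)=[u,v](x+\delta)$ (the resultant and bracket statements holding for every pair). Consequently each of the predicates $\operatorname{Disc}(u)\operatorname{Disc}(v)\operatorname{Disc}(w)\ne0$, $\operatorname{Res}(u,v)\operatorname{Res}(v,w)\operatorname{Res}(w,u)\neq0$, $\mathfrak d(u,v,w)\ne0$ (and $\mathfrak d(u,v,w)=0$), every bracket degree, and every coprimality relation among $U=[v,w]$, $V=[w,u]$, $W=[u,v]$ takes the same value before and after the shift.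
   Context: For polynomials $a,b$ the bracket is $[a,b]=a'b-ab'$ (derivatives in $x$). For $u=x^2+u_1x+u_0$, $v=x^2+v_1x+v_0$, $w=x^2+w_1x+w_0$, $$\mathfrak d(u,v,w)=\det\begin{pmatrix} u_0 & u_1 & 1 \\ v_0 & v_1 & 1 \\ w_0 & w_1 & 1 \end{pmatrix}.$$ *)

(* Defs.v *)
From HB Require Import structures.
From mathcomp Require Import all_boot all_order all_algebra.
Set Implicit Arguments.
Unset Strict Implicit.
Unset Printing Implicit Defensive.
Import GRing.Theory.
Local Open Scope ring_scope.

Definition monic_quadratic (F : fieldType) (s : {poly F}) : Prop :=
  s \is monic /\ size s = 3%N.

Definition shift (F : fieldType) (delta : F) (s : {poly F}) : {poly F} :=
  s \Po ('X + delta%:P).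

Definition bracket (F : fieldType) (a b : {poly F}) : {poly F} :=
  a^`() * b - a * b^`().

(* The usual b^2 - 4ac of ax^2 + bx + c; only meaningful for size s = 3%N. *)
Definition disc (F : fieldType) (s : {poly F}) : F :=
  s`_1 ^+ 2 - 4%:R * s`_2 * s`_0.

Definition coef_det (F : fieldType) (u v w : {poly F}) : F :=
  \det (\matrix_(i < 3, j < 3)
    (nth [::] [:: [:: u`_0; u`_1; 1];
                  [:: v`_0; v`_1; 1];
                  [:: w`_0; w`_1; 1]] i)`_j).

(* Main.v *)
Require Import Defs.
From HB Require Import structures.
From mathcomp Require Import all_boot all_order all_algebra.
From mathcomp Require Import ring.
Set Implicit Arguments.
Unset Strict Implicit.
Unset Printing Implicit Defensive.
Import GRing.Theory.
Local Open Scope ring_scope.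

(** The substitution [x |-> x + delta] is an automorphism of [F[x]], with
    inverse the substitution by [- delta], that preserves degrees and commutes
    with the derivative since [('X + delta)^`() = 1].  Brackets, their degrees,
    gcds and coprimality are built from these operations alone, so they are
    carried along by it.

    The two determinants are invariant for one common reason.  On polynomials
    of size at most [d], the shift is a linear map whose matrix [shift_mx d] in
    the basis of monomials is unitriangular, hence of determinant 1
    ([det_shift_mx]).  The determinant [coef_det u v w] is that of the matrix
    with rows [u], [v], [w], and shifting these multiplies it on the right by
    [shift_mx 3].  The rows of the Sylvester matrix of [p] and [q] are the
    ['X^i * p] and the ['X^i * q]; shifting them all multiplies the matrix on
    the right by a shift matrix.  The result consists of the rows
    [('X + delta)^i * p'] and [('X + delta)^i * q'], where [p'] and [q'] are the
    shifts of [p] and [q]: this is the Sylvester matrix of [p'] and [q']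
    multiplied on the left by the block diagonal matrix of two shift matrices
    ([shift_mulp_mx]).  Taking determinants shows that the resultant of
    arbitrary polynomials is invariant.  The discriminant is a direct
    computation on the three coefficients. *)

(** * The shift as an automorphism of the polynomial ring *)

Section ShiftMorphism.

Variables (F : fieldType) (delta : F).
Implicit Types p q : {poly F}.

Lemma size_shift p : size (shift delta p) = size p.
Proof. by rewrite /shift size_comp_poly2 // size_XaddC. Qed.

Lemma shiftM p q : shift delta (p * q) = shift delta p * shift delta q.
Proof. exact: comp_polyM. Qed.

Lemma shiftNK p : shift (- delta) (shift delta p) = p.
Proof. by rewrite /shift polyCN comp_polyXaddC_K. Qed.

Lemma deriv_shift p : (shift delta p)^`() = shift delta p^`().
Proof. by rewrite /shift deriv_comp derivD derivX derivC addr0 mulr1. Qed.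

Lemma bracket_shift p q :
  bracket (shift delta p) (shift delta q) = shift delta (bracket p q).
Proof.
by rewrite /bracket !deriv_shift -!shiftM /shift -comp_polyB.
Qed.

End ShiftMorphism.

(** Substitution preserves Bezout relations; the converse direction applies
    this to the inverse shift. *)
Lemma coprimep_shift (F : fieldType) (delta : F) (p q : {poly F}) :
  coprimep (shift delta p) (shift delta q) = coprimep p q.
Proof.
apply/idP/idP => [|cop_pq]; last exact: coprimep_comp_poly.
by move/(coprimep_comp_poly ('X + (- delta)%:P));
  rewrite -!/(shift _ _) !shiftNK.
Qed.

Lemma coprimep_gcdp_shift (F : fieldType) (delta : F) (p q r : {poly F}) :
  coprimep (gcdp (shift delta p) (shift delta q)) (shift delta r)
    = coprimep (gcdp p q) r.
Proof.
have /eqp_coprimepl <- := gcdp_comp_poly ('X + delta%:P) p q.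
exact: coprimep_shift.
Qed.

(** * The matrix of the shift on polynomials of bounded degree *)

Section ShiftMatrix.

Variables (F : fieldType) (delta : F).
Implicit Types p r : {poly F}.

Definition shift_mx d : 'M[F]_d :=
  \matrix_(i, j) (shift delta 'X^i)`_j.

(** The [i]-th row holds the coefficients of the monic [('X + delta)^i] of
    degree [i]. *)
Lemma det_shift_mx d : \det (shift_mx d) = 1.
Proof.
rewrite det_trig => [|]; last first.
  apply/is_trig_mxP => i j lt_ij; rewrite mxE nth_default //.
  by rewrite size_shift size_polyXn.
apply: big1 => i _; rewrite mxE /shift comp_Xn_poly.
have := monicP (monic_exp i (monicXaddC delta)).
by rewrite lead_coefE -comp_Xn_poly -/(shift _ _) size_shift size_polyXn.
Qed.

Lemma mul_poly_rV_shift_mx d p : (size p <= d)%N ->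
  poly_rV p *m shift_mx d = poly_rV (shift delta p) :> 'rV_d.
Proof.
move=> le_pd; apply/rowP=> j; rewrite !mxE.
have {2}->: p = \sum_(i < d) p`_i *: 'X^i.
  rewrite -poly_def; apply/polyP=> k; rewrite coef_poly.
  by case: ltnP => // /(leq_trans le_pd) /leq_sizeP->.
rewrite /shift raddf_sum coef_sum; apply: eq_bigr => i _.
by rewrite !mxE /= comp_polyZ coefZ.
Qed.

Lemma rVpoly_mul_shift_mx d (u : 'rV[F]_d) :
  rVpoly (u *m shift_mx d) = shift delta (rVpoly u).
Proof.
have sz_u : (size (rVpoly u) <= d)%N by apply: size_poly.
rewrite -{1}[u]rVpolyK mul_poly_rV_shift_mx // poly_rV_K //.
by rewrite size_shift.
Qed.

(** The block of a Sylvester matrix contributed by [r]. The dimensions are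
    parameters, instead of being computed from sizes, so that the blocks of a
    polynomial and of its shift have the same type. *)
Definition mulp_mx d n r : 'M[F]_(d, n) :=
  lin1_mx (poly_rV \o r \o* rVpoly).

(** The identity [shift (a * r) = shift a * shift r] in matrix form; the size
    condition says that [a * r] fits in [n] coefficients when [a] fits in [d]. *)
Lemma shift_mulp_mx d n r : (d + size r <= n.+1)%N ->
  mulp_mx d n r *m shift_mx n = shift_mx d *m mulp_mx d n (shift delta r).
Proof.
move=> le_n; apply/row_matrixP=> i; rewrite !rowE !mulmxA.
set u := delta_mx 0 i.
rewrite !mul_rV_lin1 /= mul_poly_rV_shift_mx ?rVpoly_mul_shift_mx ?shiftM //.
have sz_u : (size (rVpoly u) <= d)%N by apply: size_poly.
apply: leq_trans (size_polyMleq _ _) _.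
by rewrite -subn1 leq_subLR (leq_trans _ le_n) // leq_add2r.
Qed.

End ShiftMatrix.

(** * Invariance of resultant, coefficient determinant and discriminant *)

Section Invariants.

Variables (F : fieldType) (delta : F).
Implicit Types p q s u v w : {poly F}.

(** Row operations by a block diagonal matrix of determinant 1 and column
    operations by another matrix of determinant 1 relate the two Sylvester
    matrices. *)
Lemma resultant_shift p q :
  resultant (shift delta p) (shift delta q) = resultant p q.
Proof.
pose m := (size q).-1; pose n := (size p).-1.
pose Syl (a b : {poly F}) := col_mx (mulp_mx m (m + n) a) (mulp_mx n (m + n) b).
have -> : resultant p q = \det (Syl p q) by [].
have -> : resultant (shift delta p) (shift delta q)
    = \det (Syl (shift delta p) (shift delta q)).
  by rewrite /resultant /Sylvester_mx !size_shift.
have SylM : Syl p q *m shift_mx delta (m + n)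
    = block_mx (shift_mx delta m) 0 0 (shift_mx delta n)
        *m Syl (shift delta p) (shift delta q).
  rewrite mul_col_mx mul_block_col !mul0mx addr0 add0r !shift_mulp_mx //.
    by rewrite addnC -addSn leq_add2r leqSpred.
  by rewrite -addnS leq_add2l leqSpred.
have := congr1 determinant SylM.
by rewrite !det_mulmx det_ublock !det_shift_mx !mul1r mulr1.
Qed.

Lemma coef_lead_monic_quadratic s : monic_quadratic s -> s`_2 = 1.
Proof. by case=> /monicP lead1 sz_s; rewrite -lead1 lead_coefE sz_s. Qed.

Lemma shift_monic_quadratic s :
  monic_quadratic s -> monic_quadratic (shift delta s).
Proof.
case=> mon_s sz_s; split; last by rewrite size_shift.
rewrite monicE /shift lead_coef_comp ?size_XaddC //.
by rewrite lead_coefXaddC expr1n mulr1 (monicP mon_s).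
Qed.

(** The constant last column of the determinant is the column of leading
    coefficients, so that its rows are coefficient vectors. *)
Lemma coef_detE u v w :
  monic_quadratic u -> monic_quadratic v -> monic_quadratic w ->
  coef_det u v w
    = \det (\matrix_(i < 3) (poly_rV [:: u; v; w]`_i : 'rV[F]_3)).
Proof.
move=> hu hv hw; congr (\det _); apply/matrixP=> i j; rewrite !mxE.
by case: i => [[|[|[|//]]] ?]; case: j => [[|[|[|//]]] ?] //=;
  rewrite coef_lead_monic_quadratic.
Qed.

Lemma coef_det_shift u v w :
  monic_quadratic u -> monic_quadratic v -> monic_quadratic w ->
  coef_det (shift delta u) (shift delta v) (shift delta w) = coef_det u v w.
Proof.
move=> hu hv hw.
rewrite !coef_detE //; try exact: shift_monic_quadratic.
rewrite -[RHS]mulr1 -(det_shift_mx delta 3) -det_mulmx; congr (\det _).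
apply/row_matrixP=> i; rewrite row_mul !rowK.
by case: i => [[|[|[|//]]] ?] /=; rewrite mul_poly_rV_shift_mx //;
  [case: hu | case: hv | case: hw] => _ ->.
Qed.

Lemma disc_shift s : (size s <= 3)%N -> disc (shift delta s) = disc s.
Proof.
move=> sz_s.
have def_s : s = (s`_2 *: 'X + (s`_1)%:P) * 'X + (s`_0)%:P.
  apply/polyP=> -[|[|[|k]]];
    rewrite !coefE ?eqxx //= ?mulr0 ?mulr1 ?add0r ?addr0 //.
  by rewrite nth_default // (leq_trans sz_s).
have -> : shift delta s = s`_2 *: 'X * 'X + (s`_2 * delta *+ 2 + s`_1)%:P * 'X
    + (s`_2 * delta ^+ 2 + s`_1 * delta + s`_0)%:P.
  rewrite {1}def_s /shift comp_poly_MXaddC -mul_polyC comp_poly_MXaddC comp_polyC.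
  by rewrite !(rmorphD, rmorphM, rmorphMn) /=; ring.
by rewrite /disc !coefE /=; ring.
Qed.

End Invariants.

Theorem proposition4p8 (F : finFieldType) (hq : odd #|F|)
    (u v w : {poly F}) (hu : monic_quadratic u) (hv : monic_quadratic v)
    (hw : monic_quadratic w) (delta : F) :
  let u' := shift delta u in
  let v' := shift delta v in
  let w' := shift delta w in
  let U := bracket v w in
  let V := bracket w u in
  let W := bracket u v in
  let U' := bracket v' w' in
  let V' := bracket w' u' in
  let W' := bracket u' v' in
  (forall s, s \in [:: u; v; w] -> disc (shift delta s) = disc s) /\
  (forall s t, s \in [:: u; v; w] -> t \in [:: u; v; w] ->
     resultant (shift delta s) (shift delta t) = resultant s t) /\
  coef_det u' v' w' = coef_det u v w /\
  (forall s t, s \in [:: u; v; w] -> t \in [:: u; v; w] ->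
     bracket (shift delta s) (shift delta t) = shift delta (bracket s t)) /\
  (disc u' * disc v' * disc w' != 0) = (disc u * disc v * disc w != 0) /\
  (resultant u' v' * resultant v' w' * resultant w' u' != 0)
    = (resultant u v * resultant v w * resultant w u != 0) /\
  (coef_det u' v' w' != 0) = (coef_det u v w != 0) /\
  (coef_det u' v' w' == 0) = (coef_det u v w == 0) /\
  (forall s t, s \in [:: u; v; w] -> t \in [:: u; v; w] ->
     size (bracket (shift delta s) (shift delta t)) = size (bracket s t)) /\
  coprimep U' V' = coprimep U V /\
  coprimep V' W' = coprimep V W /\
  coprimep W' U' = coprimep W U /\
  coprimep (gcdp U' V') W' = coprimep (gcdp U V) W.
Proof.
have monic_quad s : s \in [:: u; v; w] -> monic_quadratic s.
  by rewrite !inE => /or3P[] /eqP->.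
move=> /=; rewrite !bracket_shift !resultant_shift coef_det_shift //.
rewrite !coprimep_shift coprimep_gcdp_shift.
rewrite !disc_shift ?(proj2 hu) ?(proj2 hv) ?(proj2 hw) //.
split=> [s /monic_quad[_ sz_s]|]; first by rewrite disc_shift ?sz_s.
split=> [s t _ _|]; first exact: resultant_shift.
split=> //; split=> [s t _ _|]; first exact: bracket_shift.
do 4![split=> //]; split=> [s t _ _|//].
by rewrite bracket_shift size_shift.
Qed.
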